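(* For the up-and-out Asian call option with payoff function $f(x)=(x-K)^+\mathbf 1\{x\le H\}$ (strike price $K$, barrier $H$), the conditional Malliavin (CMV) estimates $\mathbb E_{\mathbb Q}[\hat\theta_d\mid\boldsymbol Z]$ of delta, gamma and vega are given respectively by $$G_{\Delta,3}(K,H;\boldsymbol Z)=G_{\Delta,2}(K;\boldsymbol Z)-\big(G_{\Delta,2}(H;\boldsymbol Z)+(H-K)G_{\Delta,1}(H;\boldsymbol Z)\big);$$ $$G_{\Gamma,3}(K,H;\boldsymbol Z)=G_{\Gamma,2}(K;\boldsymbol Z)-\big(G_{\Gamma,2}(H;\boldsymbol Z)+(H-K)G_{\Gamma,1}(H;\boldsymbol Z)\big);$$ $$G_{\vartheta,3}(K,H;\boldsymbol Z)=G_{\vartheta,2}(K;\boldsymbol Z)-\big(G_{\vartheta,2}(H;\boldsymbol Z)+(H-K)G_{\vartheta,1}(H;\boldsymbol Z)\big),$$ where $G_{\Delta,1},G_{\Gamma,1},G_{\vartheta,1}$ are the CMV estimates for the binary Asian option Greeks and $G_{\Delta,2},G_{\Gamma,2},G_{\vartheta,2}$ are the CMV estimates for the Asian call option Greeks (explicit formulas in the context).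
   Context: One-asset Black–Scholes model under the risk-neutral measure $\mathbb Q$: $S_t=S_0\exp(\omega t+\sigma\tilde W_t)$, $0\le t\le T$, with $S_0>0$, $r>0$, $\sigma>0$, $\omega=r-\frac12\sigma^2$, $\tilde W$ a standard Brownian motion under $\mathbb Q$. Let $d\ge2$, $t_j=jT/d$, $S_j=S_{t_j}$, $S_A=\frac1d\sum_{j=1}^dS_j$. For a payoff function $f$, the simulation estimates $\hat\theta_d$ of the Greeks are $\hat\theta_d=e^{-rT}f(S_A)\,\mathrm{weight}(S_A,S_d,y,z)$ with $y=\frac Td\sum_{j=1}^dS_j(\tilde W_{t_j}-\sigma t_j)$, $z=\frac{T^2}{d^2}\sum_{i=1}^d\sum_{j=i}^dS_iS_j(\tilde W_{t_j}-\sigma t_j)$ and - delta: $\mathrm{weight}(x,s,y,z)=\frac{2}{S_0\sigma^2}\big(\frac{s-S_0}{Tx}-\omega\big)$; - gamma: $\mathrm{weight}(x,s,y,z)=\frac{4}{\sigma^4S_0^2T^2x^2}\big(s^2-2sS_0+S_0^2+\omega rT^2x^2-2rTsx+2\omega TS_0x\big)$; - vega: $\mathrm{weight}(x,s,y,z)=\frac{2}{\sigma^2T^2x^2}\big((s-S_0-(r-\sigma^2)Tx)y-\sigma^2z-\frac{\sigma T^2}{2}x^2\big)$. Generation of the path: $\tilde W_{t_1}=\sqrt{t_1}X_1$ and $(\tilde W_{t_2}-\tilde W_{t_1},\dots,\tilde W_{t_d}-\tilde W_{t_1})'=\boldsymbol A\boldsymbol Z$, where $X_1\sim N(0,1)$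 and $\boldsymbol Z=(X_2,\dots,X_d)'\sim N(\boldsymbol 0_{d-1},\boldsymbol I_{d-1})$ are independent under $\mathbb Q$, and $\boldsymbol A$ is a $(d-1)\times(d-1)$ real matrix with $\boldsymbol A\boldsymbol A'=\boldsymbol\Sigma$, $\boldsymbol\Sigma_{ij}=t_{\min(i,j)+1}-t_1$. $\boldsymbol A_j$ is the $j$-th row of $\boldsymbol A$ and $\boldsymbol A_0=\boldsymbol 0_{d-1}'$. Set $\tilde S_j=S_0\exp(\omega(t_j-t_1)+\sigma\boldsymbol A_{j-1}\boldsymbol Z)$, so that $S_j=\exp(\omega t_1+\sigma\sqrt{t_1}X_1)\tilde S_j$; $\tilde S_A=\frac1d\sum_{j=1}^d\tilde S_j$. $\Phi$ is the standard normal distribution function. For a level $k>0$ put $\psi=\psi(k)=\frac{\ln k-\ln\tilde S_A-\omega t_1}{\sigma\sqrt{t_1}}$, $\Phi_1=\Phi(-\psi)$, $\Phi_2=\Phi(-\sigma\sqrt{t_1}-\psi)$, $\Phi_3=\Phi(-2\sigma\sqrt{t_1}-\psi)$, $\tilde\Phi_2=\Phi(\sigma\sqrt{t_1}-\psi)$, and $\mathsf B=\sum_{j=1}^d\tilde S_j(\boldsymbol A_{j-1}\boldsymbol Z-\sigma t_j)$, $\mathsf C=\sum_{i=1}^d\sum_{j=i}^d\tilde S_i\tilde S_j(\boldsymbol A_{j-1}\boldsymbol Z-\sigma t_j)$, $\mathsf D=\sum_{i=1}^d\sum_{j=i}^d\tilde S_i\tilde S_j$. CMV estimates for the binary Asian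 option (payoff $\mathbf 1\{x>k\}$): $$G_{\Delta,1}(k;\boldsymbol Z)=\Big(\frac{2e^{-rT}\tilde S_d}{TS_0\tilde S_A\sigma^2}-\frac{2e^{-rT}\omega}{S_0\sigma^2}\Big)\Phi_1-\frac{2e^{-rT-rt_1+\sigma^2t_1}}{T\tilde S_A\sigma^2}\Phi_2,$$ $$G_{\Gamma,1}(k;\boldsymbol Z)=\frac{4e^{-rT}}{\sigma^4S_0^2T^2}\Big[\Big(\frac{\tilde S_d^2}{\tilde S_A^2}+\omega rT^2-\frac{2rT\tilde S_d}{\tilde S_A}\Big)\Phi_1+\frac{S_0^2}{\tilde S_A^2}e^{-2rt_1+3\sigma^2t_1}\Phi_3+\Big(\frac{2\omega TS_0}{\tilde S_A}-\frac{2S_0\tilde S_d}{\tilde S_A^2}\Big)e^{-rt_1+\sigma^2t_1}\Phi_2\Big],$$ $$\begin{aligned}G_{\vartheta,1}(k;\boldsymbol Z)=&\ \Phi_1\Big(\frac{2e^{-rT}(\tilde S_d-(r-\sigma^2)T\tilde S_A)}{\sigma^2T\tilde S_A^2d}\mathsf B-\frac{2e^{-rT}}{d^2\tilde S_A^2}\mathsf C-\frac{e^{-rT}}{\sigma}\Big)+\Phi_2\Big(\frac{2e^{-rT}S_0\sqrt{t_1}}{\sigma^2T\tilde S_A}\sigma\sqrt{t_1}e^{\sigma^2t_1/2-\omega t_1}-\frac{2S_0e^{-rT}}{\sigma^2Td\tilde S_A^2}e^{-rt_1+\sigma^2t_1}\mathsf B\Big)\\&+\frac{1}{\sqrt{2\pi}}e^{-\psi^2/2}\Big(\frac{2e^{-rT}\tilde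 S_d\sqrt{t_1}}{\sigma^2T\tilde S_A}-\frac{2e^{-rT}}{\sigma^2}\sqrt{t_1}(r-\sigma^2)-\frac{2e^{-rT}\sqrt{t_1}}{\tilde S_A^2d^2}\mathsf D\Big)-\frac{2e^{-rT}S_0\sqrt{t_1}}{\sigma^2T\tilde S_A}\frac{1}{\sqrt{2\pi}}e^{\sigma^2t_1/2-\omega t_1}e^{-(\psi+\sigma\sqrt{t_1})^2/2}.\end{aligned}$$ CMV estimates for the Asian call option (payoff $(x-k)^+$): $$G_{\Delta,2}(k;\boldsymbol Z)=-\frac{2e^{-rT}}{T\sigma^2}\Phi_1+\Big(\frac{2e^{-rT}\tilde S_d}{TS_0\sigma^2}e^{rt_1}-\frac{2e^{-rT}\omega\tilde S_A}{S_0\sigma^2}e^{rt_1}\Big)\tilde\Phi_2-kG_{\Delta,1}(k;\boldsymbol Z),$$ $$\begin{aligned}G_{\Gamma,2}(k;\boldsymbol Z)=&\Big(\frac{8\omega e^{-rT}}{\sigma^4S_0T}-\frac{8e^{-rT}\tilde S_d}{\sigma^4S_0T^2\tilde S_A}\Big)\Phi_1+\frac{4e^{-rT}}{\sigma^4T^2\tilde S_A}e^{-rt_1+\sigma^2t_1}\Phi_2\\&+\Big(\frac{4e^{-rT}\tilde S_d^2}{\sigma^4S_0^2T^2\tilde S_A}e^{rt_1}+\frac{4e^{-rT}\omega r\tilde S_A}{\sigma^4S_0^2}e^{rt_1}-\frac{8r\tilde S_de^{-rT}}{\sigma^4S_0^2T}e^{rt_1}\Big)\tilde\Phi_2-kG_{\Gamma,1}(k;\boldsymbol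 Z),\end{aligned}$$ $$\begin{aligned}G_{\vartheta,2}(k;\boldsymbol Z)=&-\frac{2e^{-rT}S_0}{\sigma^2T\tilde S_Ad}\mathsf B\,\Phi_1-kG_{\vartheta,1}(k;\boldsymbol Z)-\frac{2e^{-rT}S_0\sqrt{t_1}}{\sigma^2T}\frac{1}{\sqrt{2\pi}}e^{-\psi^2/2}\\&+\Big[\frac{2e^{-rT}\tilde S_d}{\sigma^2T\tilde S_Ad}\mathsf B\,e^{rt_1}+\mathsf E\,\sigma\sqrt{t_1}\,e^{\sigma^2t_1/2+\omega t_1}-\frac{2e^{-rT}(r-\sigma^2)}{\sigma^2d}\mathsf B\,e^{rt_1}-\frac{2e^{-rT}}{d^2\tilde S_A}\mathsf C\,e^{rt_1}-\frac{\tilde S_Ae^{-rT}}{\sigma}e^{rt_1}\Big]\tilde\Phi_2\\&+\mathsf E\,\frac{1}{\sqrt{2\pi}}e^{\sigma^2t_1/2+\omega t_1-(\psi-\sigma\sqrt{t_1})^2/2},\end{aligned}$$ with $\mathsf E=\frac{2e^{-rT}\tilde S_d\sqrt{t_1}}{\sigma^2T}-\frac{2e^{-rT}\tilde S_A}{\sigma^2}\sqrt{t_1}(r-\sigma^2)-\frac{2e^{-rT}\sqrt{t_1}}{\tilde S_Ad^2}\mathsf D$.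
   Formalization: The formal statement assumes that the strike does not exceed the barrier, K ≤ H; for K > H the payoff is identically zero while the stated formulas give the estimates for the payoff (K−x)1{H<x≤K}, which are not zero in general. *)

(* Defs.v *)
From HB Require Import structures.
From mathcomp Require Import all_boot all_order all_algebra.
From mathcomp Require Import all_classical all_reals all_analysis.

Set Implicit Arguments.
Unset Strict Implicit.
Unset Printing Implicit Defensive.

Import Order.TTheory GRing.Theory Num.Theory.
Import numFieldNormedType.Exports.

Local Open Scope classical_set_scope.
Local Open Scope ring_scope.

Section probability_notions.
Context {disp : measure_display} {Omega : measurableType disp} {R : realType}.
Variable P : probability Omega R.

(* Y is a version of the conditional expectation E[X | Z], i.e. with respect
   to the sigma-algebra g_sigma_preimage Z generated by the vector Z. *)
Definition is_cond_expectation n (Z : 'I_n -> Omega -> R) (X Y : Omega -> R) :=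
  [/\ P.-integrable [set: Omega] (EFin \o X),
      P.-integrable [set: Omega] (EFin \o Y),
      forall B : set R, measurable B -> g_sigma_preimage Z (Y @^-1` B)
    & forall E : set Omega, g_sigma_preimage Z E ->
        (\int[P]_(x in E) (Y x)%:E = \int[P]_(x in E) (X x)%:E)%E].

(* Standard Brownian motion on [0, T]; only the restriction of W to [0, T]
   is constrained. The second parameter of normal_prob is the standard
   deviation. *)
Record brownian_motion (T : R) (W : R -> {RV P >-> R}) : Prop := {
  bm_start : {ae P, forall x, W 0 x = 0} ;
  bm_normal : forall (s t : R) (B : set R), 0 <= s -> s < t -> t <= T ->
    measurable B ->
    P [set x | B (W t x - W s x)] = normal_prob 0 (Num.sqrt (t - s)) B ;
  bm_indep : forall n (t : nat -> R) (B : 'I_n -> set R),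
    0 <= t 0%N -> t n <= T ->
    (forall i : 'I_n, t i <= t i.+1) -> (forall i, measurable (B i)) ->
    P [set x | forall i : 'I_n, B i (W (t i.+1) x - W (t i) x)] =
    (\prod_(i < n) P [set x | B i (W (t i.+1) x - W (t i) x)%R])%E ;
  bm_continuous :
    {ae P, forall x, {within `[0, T], continuous (fun t => W t x)}} }.

Definition standard_normal (X : {RV P >-> R}) :=
  forall B : set R, measurable B -> distribution P X B = normal_prob 0 1 B.

(* Z ~ N(0, I_n), that is, the law of Z is the n-fold product of N(0, 1) *)
Definition standard_normal_vector n (Z : 'I_n -> {RV P >-> R}) :=
  forall B : 'I_n -> set R, (forall i, measurable (B i)) ->
    P [set x | forall i, B i (Z i x)] = (\prod_(i < n) normal_prob 0 1 (B i))%E.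

Definition independent_rv_vector n (X : Omega -> R) (Z : 'I_n -> Omega -> R) :=
  forall (B : set R) (E : set Omega), measurable B -> g_sigma_preimage Z E ->
    P (X @^-1` B `&` E) = (P (X @^-1` B) * P E)%E.

End probability_notions.

Definition normal_cdf {R : realType} (x : R) : R :=
  fine (normal_prob 0 1 `]-oo, x]).

Section asian_option.
Context {R : realType}.
Variables (S0 r sigma T : R).

Definition drift : R := r - sigma ^+ 2 / 2.

Definition delta_weight (x s y z : R) : R :=
  2 / (S0 * sigma ^+ 2) * ((s - S0) / (T * x) - drift).

Definition gamma_weight (x s y z : R) : R :=
  4 / (sigma ^+ 4 * S0 ^+ 2 * T ^+ 2 * x ^+ 2) *
  (s ^+ 2 - 2 * s * S0 + S0 ^+ 2 + drift * r * T ^+ 2 * x ^+ 2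
   - 2 * r * T * s * x + 2 * drift * T * S0 * x).

Definition vega_weight (x s y z : R) : R :=
  2 / (sigma ^+ 2 * T ^+ 2 * x ^+ 2) *
  ((s - S0 - (r - sigma ^+ 2) * T * x) * y - sigma ^+ 2 * z
   - sigma * T ^+ 2 / 2 * x ^+ 2).

Section discretization.
Variable d : nat.

Definition mon_date (j : nat) : R := j%:R * T / d%:R.

Local Notation t_ := mon_date.

Section along_path.
Variable w : R -> R.

Definition stock (t : R) : R := S0 * expR (drift * t + sigma * w t).

Local Notation S_ j := (stock (t_ j)).

Definition stock_avg : R := d%:R^-1 * \sum_(1 <= j < d.+1) S_ j.

Definition path_y : R :=
  T / d%:R * \sum_(1 <= j < d.+1) S_ j * (w (t_ j) - sigma * t_ j).

Definition path_z : R :=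
  T ^+ 2 / d%:R ^+ 2 *
  \sum_(1 <= i < d.+1) \sum_(i <= j < d.+1)
     S_ i * S_ j * (w (t_ j) - sigma * t_ j).

Definition greek_estimate (f : R -> R) (weight : R -> R -> R -> R -> R) : R :=
  expR (- r * T) * f stock_avg * weight stock_avg (S_ d) path_y path_z.

End along_path.

(* Covariance matrix of the increments W_{t_2} - W_{t_1}, ...,
   W_{t_d} - W_{t_1}; indices start at 0, hence the shift by 2. *)
Definition increment_cov : 'M[R]_(d.-1) :=
  \matrix_(i < d.-1, j < d.-1) (t_ (minn i j).+2 - t_ 1).

Section conditional_estimates.
Variables (A : 'M[R]_(d.-1)) (z : 'cV[R]_(d.-1)).

(* A_j Z for 1 <= j <= d-1, where A_j is row j.-1 of A in 0-based numbering,
   and A_0 Z = 0 (the value is 0 for j >= d as well). *)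
Definition row_prod (j : nat) : R :=
  if j is i.+1 then
    if insub i is Some i' then (A *m z) i' 0 else 0
  else 0.

Local Notation t1 := (t_ 1).
Local Notation rt1 := (Num.sqrt (t_ 1)).
Local Notation omega := drift.
Local Notation Phi := normal_cdf.

Definition tstock (j : nat) : R :=
  S0 * expR (omega * (t_ j - t1) + sigma * row_prod j.-1).

Definition tstock_avg : R := d%:R^-1 * \sum_(1 <= j < d.+1) tstock j.

Local Notation S_ := tstock.
Local Notation SA := tstock_avg.
Local Notation Sd := (tstock d).

Definition coefB : R :=
  \sum_(1 <= j < d.+1) S_ j * (row_prod j.-1 - sigma * t_ j).

Definition coefC : R :=
  \sum_(1 <= i < d.+1) \sum_(i <= j < d.+1)
     S_ i * S_ j * (row_prod j.-1 - sigma * t_ j).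

Definition coefD : R :=
  \sum_(1 <= i < d.+1) \sum_(i <= j < d.+1) S_ i * S_ j.

Definition coefE : R :=
  2 * expR (- r * T) * Sd * rt1 / (sigma ^+ 2 * T)
  - 2 * expR (- r * T) * SA / sigma ^+ 2 * rt1 * (r - sigma ^+ 2)
  - 2 * expR (- r * T) * rt1 / (SA * d%:R ^+ 2) * coefD.

(* The suffix of G_delta, G_gamma, G_vega is the payoff: 1 for the binary
   1{x > k}, 2 for the call (x - k)^+, 3 for the barrier call
   (x - K)^+ 1{x <= H}. *)
Section level.
Variable k : R.

Definition psi : R := (ln k - ln SA - omega * t1) / (sigma * rt1).
Definition Phi1 : R := Phi (- psi).
Definition Phi2 : R := Phi (- sigma * rt1 - psi).
Definition Phi3 : R := Phi (- 2 * sigma * rt1 - psi).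
Definition tPhi2 : R := Phi (sigma * rt1 - psi).

Definition G_delta1 : R :=
  (2 * expR (- r * T) * Sd / (T * S0 * SA * sigma ^+ 2)
   - 2 * expR (- r * T) * omega / (S0 * sigma ^+ 2)) * Phi1
  - 2 * expR (- r * T - r * t1 + sigma ^+ 2 * t1) / (T * SA * sigma ^+ 2)
    * Phi2.

Definition G_gamma1 : R :=
  4 * expR (- r * T) / (sigma ^+ 4 * S0 ^+ 2 * T ^+ 2) *
  ((Sd ^+ 2 / SA ^+ 2 + omega * r * T ^+ 2 - 2 * r * T * Sd / SA) * Phi1
   + S0 ^+ 2 / SA ^+ 2 * expR (- 2 * r * t1 + 3 * sigma ^+ 2 * t1) * Phi3
   + (2 * omega * T * S0 / SA - 2 * S0 * Sd / SA ^+ 2)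
     * expR (- r * t1 + sigma ^+ 2 * t1) * Phi2).

Definition G_vega1 : R :=
  Phi1 *
    (2 * expR (- r * T) * (Sd - (r - sigma ^+ 2) * T * SA)
       / (sigma ^+ 2 * T * SA ^+ 2 * d%:R) * coefB
     - 2 * expR (- r * T) / (d%:R ^+ 2 * SA ^+ 2) * coefC
     - expR (- r * T) / sigma)
  + Phi2 *
    (2 * expR (- r * T) * S0 * rt1 / (sigma ^+ 2 * T * SA)
       * (sigma * rt1) * expR (sigma ^+ 2 * t1 / 2 - omega * t1)
     - 2 * S0 * expR (- r * T) / (sigma ^+ 2 * T * d%:R * SA ^+ 2)
       * expR (- r * t1 + sigma ^+ 2 * t1) * coefB)
  + (Num.sqrt (2 * pi))^-1 * expR (- psi ^+ 2 / 2) *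
    (2 * expR (- r * T) * Sd * rt1 / (sigma ^+ 2 * T * SA)
     - 2 * expR (- r * T) / sigma ^+ 2 * rt1 * (r - sigma ^+ 2)
     - 2 * expR (- r * T) * rt1 / (SA ^+ 2 * d%:R ^+ 2) * coefD)
  - 2 * expR (- r * T) * S0 * rt1 / (sigma ^+ 2 * T * SA)
    * (Num.sqrt (2 * pi))^-1 * expR (sigma ^+ 2 * t1 / 2 - omega * t1)
    * expR (- (psi + sigma * rt1) ^+ 2 / 2).

Definition G_delta2 : R :=
  - (2 * expR (- r * T) / (T * sigma ^+ 2)) * Phi1
  + (2 * expR (- r * T) * Sd / (T * S0 * sigma ^+ 2) * expR (r * t1)
     - 2 * expR (- r * T) * omega * SA / (S0 * sigma ^+ 2) * expR (r * t1))
    * tPhi2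
  - k * G_delta1.

Definition G_gamma2 : R :=
  (8 * omega * expR (- r * T) / (sigma ^+ 4 * S0 * T)
   - 8 * expR (- r * T) * Sd / (sigma ^+ 4 * S0 * T ^+ 2 * SA)) * Phi1
  + 4 * expR (- r * T) / (sigma ^+ 4 * T ^+ 2 * SA)
    * expR (- r * t1 + sigma ^+ 2 * t1) * Phi2
  + (4 * expR (- r * T) * Sd ^+ 2 / (sigma ^+ 4 * S0 ^+ 2 * T ^+ 2 * SA)
       * expR (r * t1)
     + 4 * expR (- r * T) * omega * r * SA / (sigma ^+ 4 * S0 ^+ 2)
       * expR (r * t1)
     - 8 * r * Sd * expR (- r * T) / (sigma ^+ 4 * S0 ^+ 2 * T)
       * expR (r * t1)) * tPhi2
  - k * G_gamma1.

Definition G_vega2 : R :=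
  - (2 * expR (- r * T) * S0 / (sigma ^+ 2 * T * SA * d%:R)) * coefB * Phi1
  - k * G_vega1
  - 2 * expR (- r * T) * S0 * rt1 / (sigma ^+ 2 * T)
    * (Num.sqrt (2 * pi))^-1 * expR (- psi ^+ 2 / 2)
  + (2 * expR (- r * T) * Sd / (sigma ^+ 2 * T * SA * d%:R) * coefB
       * expR (r * t1)
     + coefE * sigma * rt1 * expR (sigma ^+ 2 * t1 / 2 + omega * t1)
     - 2 * expR (- r * T) * (r - sigma ^+ 2) / (sigma ^+ 2 * d%:R) * coefB
       * expR (r * t1)
     - 2 * expR (- r * T) / (d%:R ^+ 2 * SA) * coefC * expR (r * t1)
     - SA * expR (- r * T) / sigma * expR (r * t1)) * tPhi2
  + coefE * (Num.sqrt (2 * pi))^-1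
    * expR (sigma ^+ 2 * t1 / 2 + omega * t1 - (psi - sigma * rt1) ^+ 2 / 2).

End level.

Definition G_delta3 (K H : R) : R :=
  G_delta2 K - (G_delta2 H + (H - K) * G_delta1 H).

Definition G_gamma3 (K H : R) : R :=
  G_gamma2 K - (G_gamma2 H + (H - K) * G_gamma1 H).

Definition G_vega3 (K H : R) : R :=
  G_vega2 K - (G_vega2 H + (H - K) * G_vega1 H).

End conditional_estimates.
End discretization.
End asian_option.

Definition up_and_out_call {R : realType} (K H x : R) : R :=
  Num.max (x - K) 0 * (x <= H)%R%:R.

(* Main.v *)
Require Import Defs.
From HB Require Import structures.
From mathcomp Require Import all_boot all_order all_algebra.
From mathcomp Require Import all_classical all_reals all_analysis.
From mathcomp Require Import measurable_realfun ring lra.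

Set Implicit Arguments.
Unset Strict Implicit.
Unset Printing Implicit Defensive.

Import Order.TTheory GRing.Theory Num.Theory.
Import numFieldNormedType.Exports.

Local Open Scope classical_set_scope.
Local Open Scope ring_scope.

(** The barrier payoff (x - K)^+ 1{x <= H} equals x - K for K < x <= H and
    vanishes elsewhere. Write S_A = g SA with g = exp(omega t_1 + sigma
    sqrt(t_1) X_1) and SA a function of Z. For fixed Z the payoff is then
    supported on psi(K) < X_1 <= psi(H), and each discounted weight is a Laurent
    polynomial in g with coefficients affine in X_1. Hence the estimate is, on
    this interval, a finite sum of functions (b + c X_1) exp(a X_1), and since
    X_1 is standard normal and independent of Z, the conditional expectation is
    the integral of this sum against the normal density.

    Completing the square gives an explicit primitive (tilted_primitive) in
    terms of Phi and the normal density, so the integral is the difference of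
    its values at psi(K) and psi(H) (integral_tilted_affine). Let G1(k) be the
    primitive for the weight and P(k) the one for the weight times S_A, both
    taken at psi(k). These are the binary formula and G2(k) + k G1(k), for G2 the
    call formula, as an algebraic identity shows for each Greek (delta_terms1,
    delta_terms2 and their analogues). The integral is therefore
    (P(K) - K G1(K)) - (P(H) - K G1(H)) = G2(K) - (G2(H) + (H - K) G1(H))
    (integral_greek_estimate).

    That integrating X_1 out gives the conditional expectation is the freezing
    lemma (cond_expectation_independent), a form of Fubini's theorem. It requires
    the estimate to be integrable (greek_estimate_bound): on the support of the
    payoff all prices are bounded and S_A is at least K, so the estimate grows at
    most linearly in the values of the Brownian path on the monitoring dates. *)

(** * Conditioning on an independent random element *)

(** The change of variables formula holds without integrability: both sides
    are differences of the integrals of the positive and negative parts. *)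
Lemma integral_law d d' (T : measurableType d) (T' : measurableType d')
    (R : realType) (P : probability T R) (X : {RV P >-> T'}) (f : T' -> \bar R) :
  measurable_fun setT f -> (\int[distribution P X]_y f y = \int[P]_x f (X x))%E.
Proof.
move=> mf; rewrite integralE [RHS]integralE.
rewrite !ge0_integral_distribution//;
  [|exact: measurable_funeneg|exact: measurable_funepos].
congr (_ - _)%E; apply: eq_integral => x _.
  by rewrite /= [LHS]funeposE [RHS]funeposE.
by rewrite /= [LHS]funenegE [RHS]funenegE.
Qed.

(** The freezing lemma: if X and V are independent and E[h(v, X)] = g(v) for
    every v, then g(V) is a version of E[h(V, X) | V]. Independence says that
    the law of (V, X) is the product of the laws, so this is Fubini's theorem;
    measurability and integrability of g come from it too, and need not be
    read off an explicit formula for g. *)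
Section freezing.
Context {disp : measure_display} {Omega : measurableType disp} {R : realType}.
Variable P : probability Omega R.
Context {d1 d2 : measure_display} {T1 : measurableType d1}
  {T2 : measurableType d2}.
Variables (X : {RV P >-> T1}) (V : {RV P >-> T2}).
Hypothesis indep : forall B E, measurable B -> measurable E ->
  P (X @^-1` B `&` V @^-1` E) = (P (X @^-1` B) * P (V @^-1` E))%E.

Let VX w := (V w, X w).

Let mVX : measurable_fun setT VX.
Proof. exact: measurable_fun_pair. Qed.

HB.instance Definition _ := isMeasurableFun.Build _ _ _ _ VX mVX.

Let VXrv : {RV P >-> (T2 * T1)%type} := VX.
Let lawX := distribution P X.
Let lawV := distribution P V.

Lemma integral_joint_law (f : T2 * T1 -> \bar R) D : measurable D ->
  (\int[lawV \x lawX]_(z in D) f z = \int[distribution P VXrv]_(z in D) f z)%E.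
Proof.
move=> mD; apply: eq_measure_integral => A mA _.
apply: product_measure_unique => // E B mE mB.
by rewrite muleC -indep// setIC.
Qed.

Variables (h : T2 * T1 -> R) (g : T2 -> R).
Hypothesis mh : measurable_fun setT h.
Hypothesis ih : P.-integrable setT (fun w => (h (V w, X w))%:E).
Hypothesis hg : forall v, (\int[P]_w (h (v, X w))%:E = (g v)%:E)%E.

Let mEh : measurable_fun setT (EFin \o h).
Proof. exact/measurable_EFinP. Qed.

Let ihp : (lawV \x lawX)%E.-integrable setT (EFin \o h).
Proof.
apply/integrableP; split => //; rewrite integral_joint_law//.
have /integrableP[] // : (distribution P VXrv).-integrable setT (EFin \o h).
exact: integrable_pushforward.
Qed.

Let FE : fubini_F lawX (EFin \o h) = EFin \o g.
Proof.
apply/funext => v; rewrite /fubini_F integral_law ?hg//.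
exact: measurable_fun_pair2.
Qed.

Let mg : measurable_fun setT (EFin \o g).
Proof. by rewrite -FE; exact: measurable_fubini_F ihp. Qed.

Lemma measurable_freezing : measurable_fun setT g.
Proof. exact/measurable_EFinP. Qed.

Lemma integrable_freezing : P.-integrable setT (fun w => (g (V w))%:E).
Proof.
have /integrableP[_] := integrable_fubini_F ihp.
rewrite FE ge0_integral_distribution//; last exact: measurableT_comp.
by move=> igV; apply/integrableP; split => //; exact: (measurableT_comp mg).
Qed.

Lemma integral_freezing E : measurable E ->
  (\int[P]_(w in V @^-1` E) (g (V w))%:E =
   \int[P]_(w in V @^-1` E) (h (V w, X w))%:E)%E.
Proof.
move=> mE; have mET : measurable (E `*` [set: T1]) by exact: measurableX.
transitivity (\int[lawV]_(v in E) (g v)%:E)%E.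
  apply/esym; apply: integral_pushforward => //.
  by apply: integrableS integrable_freezing => //; exact: measurable_funPTI.
transitivity (\int[lawV \x lawX]_(z in E `*` [set: T1]) (h z)%:E)%E.
  rewrite [RHS]integral_mkcond -integral12_prod_meas1; last first.
    by apply/(integrable_mkcond _ mET); exact: integrableS ihp.
  rewrite integral_mkcond; apply: eq_integral => v _; rewrite /fubini_F/=.
  rewrite patchE; case: ifPn => vE.
    have <- : fubini_F lawX (EFin \o h) v = (g v)%:E by rewrite FE.
    apply: eq_integral => x _; rewrite patchE ifT//.
    by rewrite inE; split=> //; exact/set_mem.
  rewrite integral0_eq// => x _; rewrite patchE ifN//.
  by apply: contra vE; rewrite !inE => -[].
rewrite integral_joint_law//.
have -> : V @^-1` E = VXrv @^-1` (E `*` [set: T1]).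
  by apply/seteqP; split => [w Ew|w []].
apply: integral_pushforward => //.
by apply: integrableS ih => //; exact: measurable_funPTI.
Qed.

End freezing.

Section conditioning.
Context {disp : measure_display} {Omega : measurableType disp} {R : realType}.
Variable P : probability Omega R.
Variables (n : nat) (Z : 'I_n -> {RV P >-> R}).

(** Omega endowed with the sigma-algebra generated by Z *)
Local Notation Zspace := (g_sigma_algebraType
  (\big[setU/set0]_(i < n) preimage_set_system setT
     (Z i : Omega -> R) measurable)).

Lemma measurable_coordinate i : measurable_fun setT (Z i : Zspace -> R).
Proof.
move=> _ B mB; rewrite setTI; apply: sub_sigma_algebra.
rewrite (bigD1 i)//=; left.
by exists B => //; rewrite setTI.
Qed.

Lemma measurable_sub_generated (E : set Omega) :
  g_sigma_preimage (fun i => Z i : Omega -> R) E -> measurable E.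
Proof.
move: E; apply: smallest_sub; first exact: sigma_algebra_measurable.
apply: (big_ind (fun C => C `<=` measurable)) => //.
  by move=> C D CP DP; rewrite subUset.
by move=> i _ _ [B mB <-]; rewrite setTI; exact: measurable_funPTI.
Qed.

(** The identity map towards the coarser sigma-algebra serves as the random
   element V of the freezing lemma. In this way h may depend on Z through the
   sample point, and no measurable function of a vector has to be built. *)
Let forget : Omega -> Zspace := id.

Let measurable_forget : measurable_fun setT forget.
Proof. by move=> _ E mE; rewrite setTI; exact: measurable_sub_generated. Qed.

HB.instance Definition _ := isMeasurableFun.Build _ _ _ _ forget
  measurable_forget.

Lemma cond_expectation_independent (X : {RV P >-> R})
    (h : Omega -> R -> R) (g : Omega -> R) :
  independent_rv_vector P X (fun i => Z i) ->
  measurable_fun setT (fun z : Zspace * R => h z.1 z.2) ->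
  P.-integrable setT (EFin \o (fun w => h w (X w))) ->
  (forall w, \int[P]_w' (h w (X w'))%:E = (g w)%:E)%E ->
  is_cond_expectation P (fun i => Z i) (fun w => h w (X w)) g.
Proof.
move=> indep mh ih hg.
pose V : {RV P >-> Zspace} := forget.
pose hp (z : Zspace * R) := h z.1 z.2.
have mg : measurable_fun [set: Zspace] g.
  exact: (@measurable_freezing _ _ _ P _ _ _ _ X V indep hp g).
split => //.
- exact: (@integrable_freezing _ _ _ P _ _ _ _ X V indep hp g).
- by move=> B mB; have := mg measurableT B mB; rewrite setTI.
- exact: (@integral_freezing _ _ _ P _ _ _ _ X V indep hp g).
Qed.

End conditioning.

(** * Integrals against the standard normal law *)

Section normal.
Context {R : realType}.
Local Notation mu := (@lebesgue_measure R).
Implicit Types (x u v a : R).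

(** The normal density is a Radon-Nikodym derivative of the normal law, since
    it integrates to it over every measurable set. *)
Lemma ge0_integral_normal_prob (m s : R) (f : R -> \bar R) (U : set R) :
  (forall x, 0 <= f x)%E -> measurable U -> measurable_fun U f ->
  (\int[normal_prob m s]_(x in U) f x =
   \int[mu]_(x in U) (f x * (normal_pdf m s x)%:E))%E.
Proof.
move=> f0 mU mf.
pose N : {finite_measure set (measurableTypeR R) -> \bar R} := normal_prob m s.
have dom : N `<< mu by exact: normal_prob_dominates.
rewrite -[LHS](Radon_Nikodym_SigmaFinite.change_of_variables dom)//.
have mfRN : measurable_fun U (Radon_Nikodym_SigmaFinite.f N mu).
  apply: (measurable_int mu); apply: (integrableS _ _ (@subsetT _ _)) => //.
  exact: Radon_Nikodym_SigmaFinite.f_integrable.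
have mpdf : measurable_fun U (EFin \o normal_pdf m s).
  by apply/measurable_funTS/measurableT_comp => //; exact: measurable_normal_pdf.
apply: ae_eq_integral => //; [exact: emeasurable_funM..|].
apply: ae_eqe_mul2l; apply: integral_ae_eq => //.
  apply: (integrableS _ _ (@subsetT _ _)) => //.
  exact: Radon_Nikodym_SigmaFinite.f_integrable.
by move=> E EU mE; rewrite -Radon_Nikodym_SigmaFinite.f_integral.
Qed.

Lemma integral_normal_prob (m s : R) (f : R -> \bar R) (U : set R) :
  measurable U -> measurable_fun U f ->
  (\int[normal_prob m s]_(x in U) f x =
   \int[mu]_(x in U) (f x * (normal_pdf m s x)%:E))%E.
Proof.
move=> mU mf; rewrite integralE [RHS]integralE.
rewrite !ge0_integral_normal_prob//;
  [|exact: measurable_funeneg|exact: measurable_funepos].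
by congr (_ - _)%E; apply: eq_integral => x _;
  rewrite !(funeposE, funenegE) ?muleN -?mulNe maxe_pMl ?mul0e// lee_fin
    normal_pdf_ge0.
Qed.

Local Notation phi x := ((Num.sqrt (2 * pi))^-1 * expR (- x ^+ 2 / 2)).

Lemma standard_normal_pdfE x : normal_pdf 0 1 x = phi x.
Proof.
rewrite normal_pdfE// /normal_peak /normal_fun subr0 expr1n mul1r.
by rewrite [2 * pi]mulrC mulr_natr.
Qed.

Lemma is_derive_normal_cdf x : is_derive x 1 (@normal_cdf R) (phi x).
Proof.
have [] := @continuous_FTC1 R (normal_pdf 0 1) -oo%O x (x + 1).
- by rewrite ltrDl.
- by apply: integrableS (integrable_normal_pdf 0 1).
- by rewrite ltNyr.
- exact: continuous_normal_pdf.
rewrite -standard_normal_pdfE derive1E => dF dFE.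
exact: DeriveDef.
Qed.

(** A triple (a, b, c) encodes the function x |-> (b + c x) e^(a x). The class
    of finite sums of such functions contains everything that is integrated
    against the standard normal law below. *)
Definition tilted_affine (t : R * R * R) x : R :=
  (t.1.2 + t.2 * x) * expR (t.1.1 * x).

(** Minus a primitive of tilted_affine t times the standard normal density phi,
    found by completing the square, phi(x) e^(a x) = e^(a^2 / 2) phi(x - a), and
    writing b + c x = (b + c a) + c (x - a). *)
Definition tilted_primitive (t : R * R * R) x : R :=
  expR (t.1.1 ^+ 2 / 2) *
  ((t.1.2 + t.2 * t.1.1) * normal_cdf (t.1.1 - x) + t.2 * phi (x - t.1.1)).

Lemma is_derive_tilted_primitive t x :
  is_derive x 1 (tilted_primitive t) (- (tilted_affine t x * phi x)).
Proof.
case: t => [[a b] c]; rewrite /tilted_primitive /tilted_affine /=.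
have d1 : is_derive x 1 (fun x => normal_cdf (a - x)) (- phi (x - a)).
  have -> : - phi (x - a) = phi (a - x) * (- 1).
    by rewrite mulrN1 -[a - x]opprB sqrrN.
  apply: (@is_derive1_comp _ (@normal_cdf R) (fun x => a - x)).
    exact: is_derive_normal_cdf.
  by rewrite -[X in is_derive _ _ _ X]add0r; apply: is_deriveB.
have d2 : is_derive x 1 (fun x => expR (- (x - a) ^+ 2 / 2))
    (expR (- (x - a) ^+ 2 / 2) * - (x - a)).
  apply: (@is_derive1_comp _ expR (fun x => - (x - a) ^+ 2 / 2)).
  have -> : (fun x => - (x - a) ^+ 2 / 2) = (- 2^-1) \*: ((id - cst a) ^+ 2).
    by apply/funext => y /=; rewrite !fctE /GRing.scale/=; lra.
  apply: is_derive_eq; rewrite !fctE /GRing.scale/=; lra.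
have -> : (fun x => expR (a ^+ 2 / 2) *
    ((b + c * a) * normal_cdf (a - x) + c * phi (x - a))) =
  expR (a ^+ 2 / 2) \*: ((b + c * a) \*: (fun x => normal_cdf (a - x)) +
    (c / Num.sqrt (2 * pi)) \*: (fun x => expR (- (x - a) ^+ 2 / 2))).
  by apply/funext => y; rewrite !fctE /GRing.scale/= !mulrA.
apply: is_derive_eq.
rewrite /GRing.scale/=.
have -> : expR (- x ^+ 2 / 2) =
   expR (a ^+ 2 / 2) * expR (- (x - a) ^+ 2 / 2) * expR (- (a * x)).
  by rewrite -!expRD; congr expR; field.
(* ring must see that e^(a x) and e^(- a x) are inverse to each other *)
have e1 : expR (a * x) * expR (- (a * x)) = 1 by rewrite -expRD subrr expR0.
rewrite -[LHS]mulr1 -e1.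
ring.
Qed.

Lemma is_derive_sum_seq (I : Type) (s : seq I) (f : I -> R -> R)
    (df : I -> R) x :
  (forall i, is_derive x 1 (f i) (df i)) ->
  is_derive x 1 (fun y => \sum_(i <- s) f i y) (\sum_(i <- s) df i).
Proof.
move=> fi; elim: s => [|i s IH].
  under eq_fun do rewrite big_nil.
  by rewrite big_nil; exact: is_derive_cst.
under eq_fun do rewrite big_cons.
by rewrite big_cons; exact: is_deriveD.
Qed.

Lemma continuous_tilted_affine t : continuous (tilted_affine t).
Proof.
move=> x.
have mulid (k : R) : k * y @[y --> x] --> k * x.
  by apply: cvgM; [exact: cvg_cst|exact: cvg_id].
apply: cvgM; last by apply: (cvg_comp _ expR) (mulid _) _; exact: continuous_expR.
by apply: cvgD; [exact: cvg_cst|exact: mulid].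
Qed.

(** Partial moments of an exponentially tilted normal law, by the fundamental
    theorem of calculus. The truncation from both sides keeps the integral on a
    compact interval, where no integrability question arises. *)
Lemma integral_tilted_affine (s : seq (R * R * R)) u v : u <= v ->
  (\int[normal_prob 0 1]_(x in `]u, v]) (\sum_(t <- s) tilted_affine t x)%:E =
   (\sum_(t <- s) (tilted_primitive t u - tilted_primitive t v))%:E)%E.
Proof.
rewrite le_eqVlt => /predU1P[->|uv].
  by rewrite set_itvoc0 integral_set0 big1// => t _; rewrite subrr.
have mS : measurable_fun setT (fun x => \sum_(t <- s) tilted_affine t x).
  apply: measurable_sum => t.
  by apply: continuous_measurable_fun => x; exact: continuous_tilted_affine.
rewrite integral_normal_prob//; last exact/measurable_funTS/measurable_EFinP.
pose F x := - \sum_(t <- s) tilted_primitive t x.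
have dF x : is_derive x 1 F (\sum_(t <- s) tilted_affine t x * phi x).
  rewrite /F; have -> : \sum_(t <- s) tilted_affine t x * phi x =
      - \sum_(t <- s) - (tilted_affine t x * phi x) by rewrite sumrN opprK.
  apply: is_deriveN; apply: is_derive_sum_seq => t.
  exact: is_derive_tilted_primitive.
have cF x : {for x, continuous F}.
  by apply: differentiable_continuous; apply/derivable1_diffP; have [] := dF x.
have cf : continuous (fun x => \sum_(t <- s) tilted_affine t x * phi x).
  move=> x; apply: cvg_big => [|t _]; first exact: (@add_continuous R^o).
  apply: cvgM.
    exact: continuous_tilted_affine.
  under eq_fun do rewrite -standard_normal_pdfE.
  by rewrite -standard_normal_pdfE; exact: continuous_normal_pdf.
transitivity (\int[mu]_(x in `[u, v])
   (\sum_(t <- s) tilted_affine t x * phi x)%:E)%E.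
  rewrite -integral_itv_obnd_cbnd; last first.
    apply/measurable_funTS/measurable_EFinP.
    by apply: continuous_measurable_fun => x; exact: cf.
  apply: eq_integral => x _; rewrite standard_normal_pdfE -EFinM.
  by rewrite mulr_suml.
rewrite (@continuous_FTC2 _ _ F)//.
- by rewrite -EFinB; congr EFin; rewrite sumrB /F; ring.
- by apply: continuous_subspaceT => x; exact: cf.
- split.
  + by move=> x _; have [] := dF x.
  + exact/cvg_at_right_filter/cF.
  + exact/cvg_at_left_filter/cF.
- by move=> x _; rewrite derive1E; have [_ ->] := dF x.
Qed.

(** Since |x| <= e^(3 x^2 / 8), the function |x| phi(x) is at most twice the
    density of the centred normal law of standard deviation 2. *)
Lemma integrable_id_normal : (normal_prob 0 1).-integrable setT (EFin : R -> \bar R).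
Proof.
have xexp x : `|x| <= expR (3 / 8 * x ^+ 2).
  apply: le_trans (expR_ge1Dx _); rewrite ler_norml; apply/andP; split.
    by have := sqr_ge0 (x + 4 / 3); nra.
  by have := sqr_ge0 (x - 4 / 3); nra.
apply/integrableP; split; first exact: measurableT_comp.
rewrite ge0_integral_normal_prob//; last exact/measurableT_comp.
have /(integrableZl measurableT 2)/integrableP[] := integrable_normal_pdf (0 : R) 2.
move=> _; apply: le_lt_trans.
apply: ge0_le_integral => //.
- by move=> x _; rewrite mule_ge0// lee_fin normal_pdf_ge0.
- apply: emeasurable_funM; first by do 2 apply: measurableT_comp => //.
  by apply: measurableT_comp => //; exact: measurable_normal_pdf.
- apply: measurableT_comp => //; apply: emeasurable_funM => //.
  by apply: measurableT_comp => //; exact: measurable_normal_pdf.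
move=> x _ /=; rewrite lee_fin; apply: le_trans (ler_norm _).
rewrite standard_normal_pdfE normal_pdfE ?pnatr_eq0// /normal_peak /normal_fun.
have -> : (Num.sqrt (2 ^+ 2 * pi *+ 2))^-1 = 2^-1 * (Num.sqrt (2 * pi))^-1 :> R.
  have -> : 2 ^+ 2 * pi *+ 2 = 2 ^+ 2 * (2 * pi) :> R by ring.
  by rewrite sqrtrM ?sqr_ge0// invfM sqrtr_sqr ger0_norm.
rewrite -!mulrA mulVKf ?pnatr_eq0// mulrCA ler_wpM2l ?invr_ge0 ?sqrtr_ge0//.
have -> : expR (- (x - 0) ^+ 2 / (2 ^+ 2 *+ 2)) =
    expR (3 / 8 * x ^+ 2) * expR (- x ^+ 2 / 2).
  by rewrite -expRD; congr expR; field.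
by rewrite ler_wpM2r ?expR_ge0// xexp.
Qed.

(** The normal law is a measure on a second copy of the Borel space of the
    reals, so X is first turned into a variable Y with values in that copy. *)
Lemma integral_standard_normal disp (Omega : measurableType disp)
    (P : probability Omega R) (X : {RV P >-> R}) (f : R -> \bar R) :
  standard_normal X -> measurable_fun setT f ->
  (\int[P]_w f (X w) = \int[normal_prob 0 1]_x f x)%E.
Proof.
move=> XN mf.
have mX : measurable_fun setT (X : Omega -> measurableTypeR R).
  by move=> _ B mB; exact: (measurable_funPT X measurableT B mB).
pose Y : {RV P >-> measurableTypeR R} := HB.pack (X : Omega -> measurableTypeR R)
  (isMeasurableFun.Build _ _ _ _ _ mX).
transitivity (\int[distribution P Y]_x f x)%E.
  by rewrite integral_law.
pose N : probability (measurableTypeR R) R := normal_prob 0 1.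
by apply: (@eq_measure_integral _ _ _ _ N) => B mB _; exact: XN.
Qed.

Lemma integrable_standard_normal disp (Omega : measurableType disp)
    (P : probability Omega R) (X : {RV P >-> R}) :
  standard_normal X -> P.-integrable setT (EFin \o X).
Proof.
move=> XN; apply/integrableP; split; first exact/measurable_EFinP.
rewrite (@integral_standard_normal _ _ _ _ (fun x => `|x%:E|%E))//; last first.
  exact: measurableT_comp.
by have /integrableP[] := integrable_id_normal.
Qed.

Lemma standard_normal_coordinate disp (Omega : measurableType disp)
    (P : probability Omega R) n (Z : 'I_n -> {RV P >-> R}) i :
  standard_normal_vector Z -> standard_normal (Z i).
Proof.
move=> ZN B mB.
pose C j := if j == i then B else setT.
have mC j : measurable (C j) by rewrite /C; case: ifP.
have := ZN C mC; rewrite (bigD1 i)//= big1 => [|j /negPf ji]; last first.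
  by rewrite /C ji; exact: probability_setT.
rewrite mule1 {2}/C eqxx => <-; congr (P _).
apply/seteqP; split => w /=; last by move=> /(_ i); rewrite /C eqxx.
by move=> Bw j; rewrite /C; case: eqP => [->|].
Qed.

End normal.

(** * Estimates along a path with given Z *)

Section one_path.
Context {R : realType}.
Variables (S0 r sigma T : R) (d : nat).
Hypotheses (S0_gt0 : 0 < S0) (sigma_gt0 : 0 < sigma) (T_gt0 : 0 < T)
  (d_gt0 : (0 < d)%N).
Variables (A : 'M[R]_(d.-1)) (z : 'cV[R]_(d.-1)).

Local Notation t1 := (mon_date T d 1).
Local Notation rt1 := (Num.sqrt t1).
Local Notation omega := (drift r sigma).
Local Notation SA := (tstock_avg S0 r sigma T A z).
Local Notation Sd := (tstock S0 r sigma T A z d).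
Local Notation B := (Defs.coefB S0 r sigma T A z).
Local Notation C := (Defs.coefC S0 r sigma T A z).
Local Notation D := (Defs.coefD S0 r sigma T A z).
Local Notation psi k := (psi S0 r sigma T A z k).
Local Notation vol := (sigma * rt1).
Local Notation growth := (expR (omega * t1)).
Local Notation disc := (expR (- r * T)).

(** This is S_{t_1} / S_0 for X_1 = x, the factor of S_j that does not
    depend on Z. *)
Definition first_factor x : R := growth * expR (vol * x).

Lemma first_factor_gt0 x : 0 < first_factor x.
Proof. by rewrite mulr_gt0 ?expR_gt0. Qed.

Lemma t1_gt0 : 0 < t1.
Proof. by rewrite /mon_date divr_gt0 ?mul1r ?ltr0n. Qed.

Lemma vol_gt0 : 0 < vol.
Proof. by rewrite mulr_gt0// sqrtr_gt0 t1_gt0. Qed.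

Lemma tstock_gt0 j : 0 < tstock S0 r sigma T A z j.
Proof. by rewrite mulr_gt0// expR_gt0. Qed.

Lemma tstock_avg_gt0 : 0 < SA.
Proof.
rewrite mulr_gt0 ?invr_gt0 ?ltr0n// big_nat_recr//=.
by rewrite ltr_wpDl ?tstock_gt0// sumr_ge0// => i _; exact/ltW/tstock_gt0.
Qed.

Lemma tstock_sum : \sum_(1 <= j < d.+1) tstock S0 r sigma T A z j = d%:R * SA.
Proof. by rewrite mulVKf// pnatr_eq0 -lt0n. Qed.

(** The path is determined on the monitoring dates by Z and the value x of X_1,
    and then x enters the average, S_d, y and z through simple factors. *)
Section factorization.
Variables (w : R -> R) (x : R).
Hypothesis wE : forall j, (0 < j <= d)%N ->
  w (mon_date T d j) = rt1 * x + row_prod A z j.-1.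

Lemma stock_factor j : (0 < j <= d)%N ->
  stock S0 r sigma w (mon_date T d j) =
  first_factor x * tstock S0 r sigma T A z j.
Proof.
move=> jd; rewrite /stock /tstock /first_factor wE// -expRD [RHS]mulrCA -expRD.
by congr (_ * expR _); ring.
Qed.

Lemma stock_avg_factor : stock_avg S0 r sigma T d w = first_factor x * SA.
Proof.
rewrite /stock_avg /tstock_avg [RHS]mulrCA; congr (_ * _); rewrite mulr_sumr.
by apply: eq_big_nat => j; exact: stock_factor.
Qed.

Lemma path_y_factor : path_y S0 r sigma T d w =
  T / d%:R * first_factor x * (B + rt1 * x * (d%:R * SA)).
Proof.
rewrite /path_y -tstock_sum -[RHS]mulrA; congr (_ * _).
rewrite [X in _ + X]mulr_sumr /Defs.coefB -big_split/= mulr_sumr.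
apply: eq_big_nat => j jd; rewrite wE// stock_factor//.
by ring.
Qed.

Lemma path_z_factor : path_z S0 r sigma T d w =
  T ^+ 2 / d%:R ^+ 2 * first_factor x ^+ 2 * (C + rt1 * x * D).
Proof.
rewrite /path_z -[RHS]mulrA /Defs.coefC /Defs.coefD; congr (_ * _).
rewrite [X in _ + X]mulr_sumr -big_split/= mulr_sumr.
apply: eq_big_nat => i /andP[i0 id].
rewrite [X in _ + X]mulr_sumr -big_split/= mulr_sumr.
apply: eq_big_nat => j /andP[ij jd].
have j0 : (0 < j)%N by exact: leq_trans ij.
rewrite wE ?j0//  !stock_factor ?j0 ?i0//.
by ring.
Qed.

End factorization.

(** The threshold psi k is where the average crosses the level k. *)
Lemma lt_psi k x : 0 < k -> (psi k < x) = (k < first_factor x * SA).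
Proof.
move=> k0; rewrite /Defs.psi ltr_pdivrMr ?vol_gt0//.
rewrite -[in RHS](@lnK _ k)// -[in RHS](@lnK _ SA) ?posrE ?tstock_avg_gt0//.
rewrite /first_factor -!expRD ltr_expR.
by apply/idP/idP => h; lra.
Qed.

(** The payoff of the barrier option is the affine function g SA - K of the
    first factor g, cut off to an interval of values of X_1. *)
Lemma greek_estimate_first_factor (w : R -> R) x K H weight :
  (forall j, (0 < j <= d)%N ->
    w (mon_date T d j) = rt1 * x + row_prod A z j.-1) ->
  0 < K -> K <= H ->
  let g := first_factor x in
  greek_estimate S0 r sigma T d w (up_and_out_call K H) weight =
  (x \in `]psi K, psi H])%:R * (g * SA - K) * (disc *
  weight (g * SA) (g * Sd) (T / d%:R * g * (B + rt1 * x * (d%:R * SA)))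
    (T ^+ 2 / d%:R ^+ 2 * g ^+ 2 * (C + rt1 * x * D))).
Proof.
move=> wE K0 KH g; rewrite /greek_estimate (stock_avg_factor wE).
rewrite (path_y_factor wE) (path_z_factor wE) (stock_factor wE); last first.
  by rewrite d_gt0 leqnn.
rewrite in_itv/= lt_psi// [x <= _]leNgt lt_psi ?(lt_le_trans K0)// -leNgt.
rewrite /up_and_out_call -/g; case: (ltP K (g * SA)) => gK /=.
  by rewrite max_l ?subr_ge0 ?(ltW gK)//; ring.
by rewrite max_r ?subr_le0//; ring.
Qed.

(** Multiplication by the average price, on the level of triples. *)
Definition times_avg (t : R * R * R) :=
  (t.1.1 + vol, growth * SA * t.1.2, growth * SA * t.2).

Lemma tilted_affine_times_avg t x :
  tilted_affine (times_avg t) x = first_factor x * SA * tilted_affine t x.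
Proof.
rewrite /tilted_affine /first_factor /=.
have -> : (t.1.1 + vol) * x = t.1.1 * x + vol * x by ring.
by rewrite expRD; ring.
Qed.

(** For fixed Z the discounted weights are Laurent polynomials in the first
    factor whose coefficients are affine in x, hence sums of tilted affine
    functions. The exponents - vol and - vol - vol stand for the powers -1 and
    -2 of the first factor. *)
Definition delta_terms : seq (R * R * R) :=
  [:: (0, disc * (2 / (S0 * sigma ^+ 2)) * (Sd / (T * SA) - omega), 0);
      (- vol, - (disc * (2 / (S0 * sigma ^+ 2)) * (S0 / (T * SA)) / growth), 0)].

Definition gamma_terms : seq (R * R * R) :=
  let c := 4 * disc / (sigma ^+ 4 * S0 ^+ 2 * T ^+ 2) in
  [:: (0, c * (Sd ^+ 2 / SA ^+ 2 + omega * r * T ^+ 2 - 2 * r * T * Sd / SA), 0);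
      (- vol, c * (2 * omega * T * S0 / SA - 2 * S0 * Sd / SA ^+ 2) / growth, 0);
      (- vol - vol, c * (S0 ^+ 2 / SA ^+ 2) / growth ^+ 2, 0)].

Definition vega_terms : seq (R * R * R) :=
  let p := 2 * disc / (sigma ^+ 2 * T * d%:R * SA ^+ 2) in
  let q := 2 * disc / (d%:R ^+ 2 * SA ^+ 2) in
  let u := Sd - (r - sigma ^+ 2) * T * SA in
  [:: (0, p * u * B - q * C - disc / sigma, rt1 * (p * u * (d%:R * SA) - q * D));
      (- vol, - (p * S0 * B / growth), - (p * S0 * rt1 * (d%:R * SA) / growth))].

Lemma delta_weight_terms x y v :
  disc * delta_weight S0 r sigma T (first_factor x * SA) (first_factor x * Sd) y v
  = \sum_(t <- delta_terms) tilted_affine t x.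
Proof.
rewrite !big_cons big_nil /tilted_affine /delta_weight /first_factor /=.
rewrite mul0r expR0 (mulNr vol) (expRN (vol * x)).
by field; rewrite !gt_eqF ?expR_gt0 ?tstock_avg_gt0//.
Qed.

Lemma gamma_weight_terms x y v :
  disc * gamma_weight S0 r sigma T (first_factor x * SA) (first_factor x * Sd) y v
  = \sum_(t <- gamma_terms) tilted_affine t x.
Proof.
rewrite !big_cons big_nil /tilted_affine /gamma_weight /first_factor /=.
rewrite mul0r expR0.
have -> : (- vol - vol) * x = - (vol * x) + - (vol * x) by ring.
rewrite (mulNr vol) (expRD (- (vol * x))) (expRN (vol * x)).
by field; rewrite !gt_eqF ?expR_gt0 ?tstock_avg_gt0//.
Qed.

Lemma vega_weight_terms x : let g := first_factor x in
  disc * vega_weight S0 r sigma T (g * SA) (g * Sd)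
    (T / d%:R * g * (B + rt1 * x * (d%:R * SA)))
    (T ^+ 2 / d%:R ^+ 2 * g ^+ 2 * (C + rt1 * x * D))
  = \sum_(t <- vega_terms) tilted_affine t x.
Proof.
rewrite !big_cons big_nil /tilted_affine /vega_weight /first_factor /=.
rewrite mul0r expR0 (mulNr vol) (expRN (vol * x)).
by field; rewrite !gt_eqF ?expR_gt0 ?tstock_avg_gt0 ?ltr0n//.
Qed.

Lemma expR_growth_vol : expR (r * t1) = growth * expR (vol ^+ 2 / 2).
Proof.
rewrite -expRD exprMn sqr_sqrtr ?(ltW t1_gt0)// /drift.
by congr expR; field.
Qed.

Lemma expR_volV_growth :
  expR (- r * t1 + sigma ^+ 2 * t1) = expR (vol ^+ 2 / 2) / growth.
Proof.
rewrite -expRN -!expRD exprMn sqr_sqrtr ?(ltW t1_gt0)// /drift.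
by congr expR; field.
Qed.

(** For each Greek, the binary formula at level k is the value at psi k of the
    primitive attached to the weight, that is, the expectation of the weight
    over the event X_1 > psi k. The call formula comes from the weight multiplied
    by the average, and k times the binary formula is subtracted. *)
Lemma delta_terms1 k :
  G_delta1 S0 r sigma T A z k =
  \sum_(t <- delta_terms) tilted_primitive t (psi k).
Proof.
rewrite !big_cons big_nil /tilted_primitive /G_delta1 /Defs.Phi1 /Defs.Phi2 /=.
rewrite !mul0r !addr0 sub0r sqrrN expr0n/= mul0r expR0 (mulNr sigma).
have -> : expR (- r * T - r * t1 + sigma ^+ 2 * t1) =
    disc * (expR (vol ^+ 2 / 2) / growth).
  by rewrite -expR_volV_growth -expRD; congr expR; ring.
by field; rewrite !gt_eqF ?expR_gt0 ?tstock_avg_gt0//.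
Qed.

Lemma delta_terms2 k :
  G_delta2 S0 r sigma T A z k =
  \sum_(t <- map times_avg delta_terms) tilted_primitive t (psi k)
  - k * G_delta1 S0 r sigma T A z k.
Proof.
rewrite /= !big_cons big_nil /tilted_primitive /G_delta2 /=.
rewrite /Defs.Phi1 /Defs.tPhi2 expR_growth_vol.
rewrite addNr !add0r expr0n/= mul0r expR0 !mulr0 !mul0r !addr0.
by field; rewrite !gt_eqF ?expR_gt0 ?tstock_avg_gt0//.
Qed.

Lemma gamma_terms1 k :
  G_gamma1 S0 r sigma T A z k =
  \sum_(t <- gamma_terms) tilted_primitive t (psi k).
Proof.
rewrite !big_cons big_nil /tilted_primitive /G_gamma1.
rewrite /Defs.Phi1 /Defs.Phi2 /Defs.Phi3 /=.
rewrite !mul0r !addr0 sub0r sqrrN expr0n/= mul0r expR0 (mulNr sigma).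
have -> : - 2 * sigma * rt1 - psi k = - vol - vol - psi k by ring.
have -> : (- vol - vol) ^+ 2 / 2 = 4 * (vol ^+ 2 / 2) by field.
rewrite expRM_natl.
have -> : expR (- 2 * r * t1 + 3 * sigma ^+ 2 * t1) =
    expR (vol ^+ 2 / 2) ^+ 4 / growth ^+ 2.
  rewrite -!expRM_natl -expRN -!expRD exprMn sqr_sqrtr ?(ltW t1_gt0)// /drift.
  by congr expR; field.
rewrite expR_volV_growth.
by field; rewrite !gt_eqF ?expR_gt0 ?tstock_avg_gt0//.
Qed.

Lemma gamma_terms2 k :
  G_gamma2 S0 r sigma T A z k =
  \sum_(t <- map times_avg gamma_terms) tilted_primitive t (psi k)
  - k * G_gamma1 S0 r sigma T A z k.
Proof.
rewrite /= !big_cons big_nil /tilted_primitive /G_gamma2 /=.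
rewrite /Defs.Phi1 /Defs.Phi2 /Defs.tPhi2 expR_growth_vol.
rewrite subrK addNr !add0r expr0n/= mul0r expR0 !mulr0 !mul0r !addr0.
rewrite expR_volV_growth.
rewrite sqrrN (mulNr sigma).
by field; rewrite !gt_eqF ?expR_gt0 ?tstock_avg_gt0//.
Qed.

Lemma vega_terms1 k :
  G_vega1 S0 r sigma T A z k =
  \sum_(t <- vega_terms) tilted_primitive t (psi k).
Proof.
rewrite !big_cons big_nil /tilted_primitive /G_vega1.
rewrite /Defs.Phi1 /Defs.Phi2 /=.
rewrite !mulr0 !addr0 sub0r subr0 sqrrN expr0n/= mul0r expR0 (mulNr sigma) opprK.
rewrite expR_volV_growth.
have -> : expR (sigma ^+ 2 * t1 / 2 - omega * t1) = expR (vol ^+ 2 / 2) / growth.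
  by rewrite -expRN -!expRD exprMn sqr_sqrtr ?(ltW t1_gt0).
by field; rewrite !gt_eqF ?expR_gt0 ?tstock_avg_gt0 ?sqrtr_gt0
  ?mulr_gt0 ?pi_gt0 ?ltr0n//.
Qed.

Lemma vega_terms2 k :
  G_vega2 S0 r sigma T A z k =
  \sum_(t <- map times_avg vega_terms) tilted_primitive t (psi k)
  - k * G_vega1 S0 r sigma T A z k.
Proof.
rewrite /= !big_cons big_nil /tilted_primitive /G_vega2 /Defs.coefE /=.
rewrite /Defs.Phi1 /Defs.Phi2 /Defs.tPhi2 expR_growth_vol.
rewrite addNr !add0r subr0 expr0n/= mul0r expR0 !mulr0 !addr0.
have -> : expR (sigma ^+ 2 * t1 / 2 + omega * t1) = growth * expR (vol ^+ 2 / 2).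
  by rewrite -expRD exprMn sqr_sqrtr ?(ltW t1_gt0)// addrC.
have -> : expR (sigma ^+ 2 * t1 / 2 + omega * t1 - (psi k - vol) ^+ 2 / 2) =
    growth * expR (vol ^+ 2 / 2) * expR (- (psi k - vol) ^+ 2 / 2).
  by rewrite -!expRD exprMn sqr_sqrtr ?(ltW t1_gt0)//; congr expR; ring.
by field; rewrite !gt_eqF ?expR_gt0 ?tstock_avg_gt0 ?sqrtr_gt0
  ?mulr_gt0 ?pi_gt0 ?ltr0n//.
Qed.

End one_path.

Section barrier_integral.
Context {R : realType}.
Variables (S0 r sigma T : R) (d : nat).
Hypotheses (S0_gt0 : 0 < S0) (sigma_gt0 : 0 < sigma) (T_gt0 : 0 < T)
  (d_gt0 : (0 < d)%N).
Variables (A : 'M[R]_(d.-1)) (z : 'cV[R]_(d.-1)).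
Variables (w : R -> R -> R) (K H : R).
Hypotheses (wE : forall x j, (0 < j <= d)%N -> w x (mon_date T d j) =
    Num.sqrt (mon_date T d 1) * x + row_prod A z j.-1)
  (K_gt0 : 0 < K) (le_KH : K <= H).
Local Notation SA := (tstock_avg S0 r sigma T A z).
Local Notation psi k := (psi S0 r sigma T A z k).
Local Notation times_avg := (times_avg S0 r sigma T A z).

Lemma le_psi : psi K <= psi H.
Proof.
rewrite /Defs.psi ler_pM2r ?invr_gt0 ?vol_gt0//.
have KH : ln K <= ln H by rewrite ler_ln// posrE (lt_le_trans K_gt0).
lra.
Qed.

(** On the interval between psi K and psi H the discounted payoff times weight
    is the weight multiplied by the average, minus K times the weight. Its
    integral is a difference of primitives, and at level k these add up to
    G2 k + (k - K) G1 k, whence the combination of G1 and G2 below. *)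
Lemma integral_greek_estimate (weight : R -> R -> R -> R -> R)
    (L : seq (R * R * R)) (G1 G2 : R -> R) :
  (forall x, let g := first_factor r sigma T d x in
     expR (- r * T) * weight (g * SA) (g * tstock S0 r sigma T A z d)
       (T / d%:R * g * (Defs.coefB S0 r sigma T A z +
          Num.sqrt (mon_date T d 1) * x * (d%:R * SA)))
       (T ^+ 2 / d%:R ^+ 2 * g ^+ 2 * (Defs.coefC S0 r sigma T A z +
          Num.sqrt (mon_date T d 1) * x * Defs.coefD S0 r sigma T A z))
     = \sum_(t <- L) tilted_affine t x) ->
  (forall k, G1 k = \sum_(t <- L) tilted_primitive t (psi k)) ->
  (forall k, G2 k =
     \sum_(t <- map times_avg L) tilted_primitive t (psi k) - k * G1 k) ->
  (\int[normal_prob 0 1]_x (greek_estimate S0 r sigma T d (w x)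
     (up_and_out_call K H) weight)%:E =
   (G2 K - (G2 H + (H - K) * G1 H))%:E)%E.
Proof.
move=> weightE G1E G2E.
pose scaleK (t : R * R * R) : R * R * R :=
    (t.1.1, - K * t.1.2, - K * t.2).
pose s := map times_avg L ++ map scaleK L.
transitivity (\int[normal_prob 0 1]_(x in `]psi K, psi H])
    (\sum_(t <- s) tilted_affine t x)%:E)%E.
  rewrite [RHS]integral_mkcond; apply: eq_integral => x _.
  rewrite patchE (greek_estimate_first_factor r S0_gt0 sigma_gt0 T_gt0 d_gt0
    weight (wE x))// weightE.
  rewrite mem_setE; case: ifP => _; last by rewrite !mul0r.
  congr EFin; rewrite mul1r mulrBl !mulr_sumr -sumrN /s big_cat !big_map/=.
  congr (_ + _); apply: eq_bigr => t _.
    by rewrite tilted_affine_times_avg.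
  by rewrite /tilted_affine /=; ring.
rewrite integral_tilted_affine ?le_psi//; congr EFin.
have PK p : \sum_(t <- map scaleK L) tilted_primitive t p =
    - K * \sum_(t <- L) tilted_primitive t p.
  rewrite big_map mulr_sumr; apply: eq_bigr => t _.
  by rewrite /tilted_primitive/=; ring.
by rewrite sumrB /s !big_cat/= !PK -!G1E !G2E; ring.
Qed.

End barrier_integral.

(** * Measurability *)

Section measurability.
Context {R : realType} {disp : measure_display} {U : measurableType disp}.
Implicit Types f g : U -> R.

(** On positive numbers, inversion is the power function of exponent -1. *)
Lemma measurable_funV f : measurable_fun setT f -> (forall u, 0 < f u) ->
  measurable_fun setT (fun u => (f u)^-1).
Proof.
move=> mf f0; under eq_fun do rewrite -powR_inv1 ?ltW//.
exact: (measurableT_comp (measurable_powR (-1)) mf).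
Qed.

Lemma measurable_up_and_out_call (K H : R) :
  measurable_fun setT (up_and_out_call K H).
Proof.
apply: measurable_funM.
  apply: (@measurable_maxr _ R R setT (fun x => x - K) (cst 0)) => //.
  exact: measurable_funB.
rewrite (_ : (fun x => (x <= H)%R%:R) = \1_`]-oo, H]); last first.
  by apply/funext => x; rewrite indicE mem_setE in_itv.
exact: measurable_indic.
Qed.

(** Positivity of the first argument, an average price, is required because the
    weights divide by it. *)
Definition preserves_measurability (weight : R -> R -> R -> R -> R) :=
  forall x s y v : U -> R, measurable_fun setT x -> measurable_fun setT s ->
    measurable_fun setT y -> measurable_fun setT v -> (forall u, 0 < x u) ->
    measurable_fun setT (fun u => weight (x u) (s u) (y u) (v u)).

Variables (S0 r sigma T : R) (d : nat).
Hypotheses (S0_gt0 : 0 < S0) (sigma_gt0 : 0 < sigma) (T_gt0 : 0 < T)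
  (d_gt0 : (0 < d)%N).

Lemma measurable_delta_weight :
  preserves_measurability (delta_weight S0 r sigma T).
Proof.
move=> x s y v mx ms my mv x0; apply: measurable_funM => //.
apply: measurable_funB => //; apply: measurable_funM.
  exact: measurable_funB.
apply: measurable_funV; first exact: measurable_funM.
by move=> u; rewrite mulr_gt0.
Qed.

Lemma measurable_gamma_weight :
  preserves_measurability (gamma_weight S0 r sigma T).
Proof.
move=> x s y v mx ms my mv x0; apply: measurable_funM.
  apply: measurable_funM => //; apply: measurable_funV.
    by apply: measurable_funM => //; exact: measurable_funX.
  by move=> u; rewrite !mulr_gt0// exprn_gt0.
have mX f : measurable_fun setT f -> measurable_fun setT (fun u => f u ^+ 2).
  exact: measurable_funX.
repeat first [exact: measurable_cst|assumption|exact: mX|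
  apply: measurable_funB|apply: measurable_funD|apply: measurable_funM].
Qed.

Lemma measurable_vega_weight :
  preserves_measurability (vega_weight S0 r sigma T).
Proof.
move=> x s y v mx ms my mv x0; apply: measurable_funM.
  apply: measurable_funM => //; apply: measurable_funV.
    by apply: measurable_funM => //; exact: measurable_funX.
  by move=> u; rewrite !mulr_gt0// exprn_gt0.
have mX f : measurable_fun setT f -> measurable_fun setT (fun u => f u ^+ 2).
  exact: measurable_funX.
repeat first [exact: measurable_cst|assumption|exact: mX|
  apply: measurable_funB|apply: measurable_funD|apply: measurable_funM].
Qed.

Lemma measurable_greek_estimate (w : U -> R -> R) (f : R -> R) weight :
  (forall j, (0 < j <= d)%N -> measurable_fun setT (w ^~ (mon_date T d j))) ->
  measurable_fun setT f -> preserves_measurability weight ->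
  measurable_fun setT (fun u => greek_estimate S0 r sigma T d (w u) f weight).
Proof.
move=> mw mf mweight.
have msum (F : nat -> U -> R) m : (0 < m)%N ->
    (forall j, (0 < j <= d)%N -> measurable_fun setT (F j)) ->
    measurable_fun setT (fun u => \sum_(m <= j < d.+1) F j u).
  move=> m0 mF; under eq_fun do rewrite big_nat_cond big_mkcond/=.
  apply: measurable_sum => j; rewrite andbT.
  have [/andP[mj jd]|_] := boolP (m <= j < d.+1)%N; last exact: measurable_cst.
  by apply: mF; rewrite (leq_trans m0).
have mS j : (0 < j <= d)%N ->
    measurable_fun setT (fun u => stock S0 r sigma (w u) (mon_date T d j)).
  move=> jd; apply: measurable_funM => //; apply: measurableT_comp => //.
  by apply: measurable_funD => //; apply: measurable_funM => //; exact: mw.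
have mSw j : (0 < j <= d)%N -> measurable_fun setT
    (fun u => w u (mon_date T d j) - sigma * mon_date T d j).
  by move=> jd; apply: measurable_funB => //; exact: mw.
have mavg : measurable_fun setT (fun u => stock_avg S0 r sigma T d (w u)).
  by apply: measurable_funM => //; exact: msum.
apply: measurable_funM.
  by apply: measurable_funM => //; exact: measurableT_comp.
apply: mweight => //.
- by apply: mS; rewrite d_gt0 leqnn.
- apply: measurable_funM => //; apply: msum => // j jd.
  by apply: measurable_funM; [exact: mS|exact: mSw].
- apply: measurable_funM => //; apply: (msum) => // i /andP[i0 id].
  apply: msum => // j jd.
  apply: measurable_funM; last exact: mSw.
  by apply: measurable_funM; apply: mS; rewrite ?i0.
- move=> u; rewrite mulr_gt0 ?invr_gt0 ?ltr0n// big_nat_recr//=.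
  rewrite ltr_wpDl ?mulr_gt0 ?expR_gt0// sumr_ge0// => i _.
  by rewrite mulr_ge0 ?expR_ge0 ?ltW.
Qed.

End measurability.

(** * Integrability of the simulation estimates *)

Section domination.
Context {R : realType}.
Variables (K H M : R).
Hypothesis K_gt0 : 0 < K.

(** Bounded for averages in [K, H] and final prices in [0, M]. Since K > 0,
    dividing by the average is harmless. *)
Definition bounded_on (b : R -> R -> R) := exists2 C, 0 <= C &
  forall x s, K <= x <= H -> 0 <= s <= M -> `|b x s| <= C.

Lemma bounded_on_cst c : bounded_on (fun _ _ => c).
Proof. by exists `|c|. Qed.

Lemma bounded_on_avg : bounded_on (fun x _ => x).
Proof.
exists `|H| => // x s /andP[Kx xH] _.
have x0 : 0 < x by exact: lt_le_trans Kx.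
by rewrite (ger0_norm (ltW x0)) (le_trans xH)// ler_norm.
Qed.

Lemma bounded_on_stock : bounded_on (fun _ s => s).
Proof.
exists `|M| => // x s _ /andP[s0 sM].
by rewrite (ger0_norm s0) (le_trans sM)// ler_norm.
Qed.

Lemma bounded_on_inv_avg : bounded_on (fun x _ => x^-1).
Proof.
exists K^-1 => [|x s /andP[Kx _] _]; first by rewrite invr_ge0 ltW.
have x0 : 0 < x by exact: lt_le_trans Kx.
by rewrite ger0_norm ?invr_ge0 ?(ltW x0)// lef_pV2 ?posrE.
Qed.

Lemma bounded_onD a b : bounded_on a -> bounded_on b ->
  bounded_on (fun x s => a x s + b x s).
Proof.
move=> [C C0 aC] [D D0 bD]; exists (C + D) => [|x s xK sM].
  exact: addr_ge0.
by rewrite (le_trans (ler_normD _ _))// lerD ?aC ?bD.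
Qed.

Lemma bounded_onM a b : bounded_on a -> bounded_on b ->
  bounded_on (fun x s => a x s * b x s).
Proof.
move=> [C C0 aC] [D D0 bD]; exists (C * D) => [|x s xK sM].
  exact: mulr_ge0.
by rewrite normrM ler_pM ?aC ?bD.
Qed.

(** The last two arguments stand for y and z, which are unbounded even on the
    support of the payoff. *)
Definition linear_growth (weight : R -> R -> R -> R -> R) :=
  exists2 C, 0 <= C & forall x s y v, K <= x <= H -> 0 <= s <= M ->
    `|weight x s y v| <= C * (1 + `|y| + `|v|).

Lemma linear_growth_affine (weight : R -> R -> R -> R -> R)
    (b0 b1 b2 : R -> R -> R) :
  bounded_on b0 -> bounded_on b1 -> bounded_on b2 ->
  (forall x s y v, 0 < x -> weight x s y v = b0 x s + b1 x s * y + b2 x s * v) ->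
  linear_growth weight.
Proof.
move=> [C0 C0p bC0] [C1 C1p bC1] [C2 C2p bC2] wE.
exists (C0 + C1 + C2) => [|x s y v xK sM]; first by rewrite !addr_ge0.
rewrite wE; last by case/andP: xK => Kx _; exact: lt_le_trans Kx.
have h0 := bC0 _ _ xK sM; have h1 := bC1 _ _ xK sM; have h2 := bC2 _ _ xK sM.
rewrite (le_trans (ler_normD _ _))// (le_trans (lerD (ler_normD _ _) (lexx _)))//.
rewrite !normrM.
have := ler_pM (normr_ge0 _) (normr_ge0 y) h1 (lexx _).
have := ler_pM (normr_ge0 _) (normr_ge0 v) h2 (lexx _).
have := normr_ge0 y; have := normr_ge0 v; nra.
Qed.

Variables (S0 r sigma T : R) (d : nat).
Hypotheses (S0_gt0 : 0 < S0) (sigma_gt0 : 0 < sigma) (T_gt0 : 0 < T)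
  (d_gt0 : (0 < d)%N).

Ltac solve_bounded_on := repeat first
  [ exact: bounded_on_cst | exact: bounded_on_avg | exact: bounded_on_stock
  | exact: bounded_on_inv_avg | apply: bounded_onD | apply: bounded_onM ].

Lemma linear_growth_delta_weight : linear_growth (delta_weight S0 r sigma T).
Proof.
apply: (@linear_growth_affine _
  (fun x s => 2 / (S0 * sigma ^+ 2) * ((s + - S0) * T^-1 * x^-1 + - drift r sigma))
  (fun _ _ => 0) (fun _ _ => 0)); [solve_bounded_on..|].
move=> x s y v x0; rewrite /delta_weight.
by field; rewrite !gt_eqF.
Qed.

Lemma linear_growth_gamma_weight : linear_growth (gamma_weight S0 r sigma T).
Proof.
apply: (@linear_growth_affine _
  (fun x s => 4 / (sigma ^+ 4 * S0 ^+ 2 * T ^+ 2) *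
    ((s + - S0) * (s + - S0) * x^-1 * x^-1 + drift r sigma * r * T ^+ 2
     + (- 2 * r * T) * s * x^-1 + 2 * drift r sigma * T * S0 * x^-1))
  (fun _ _ => 0) (fun _ _ => 0)); [solve_bounded_on..|].
move=> x s y v x0; rewrite /gamma_weight.
by field; rewrite !gt_eqF.
Qed.

Lemma linear_growth_vega_weight : linear_growth (vega_weight S0 r sigma T).
Proof.
apply: (@linear_growth_affine _ (fun _ _ => - sigma^-1)
  (fun x s => 2 / (sigma ^+ 2 * T ^+ 2) *
    ((s + - S0) * x^-1 * x^-1 + (- (r - sigma ^+ 2) * T) * x^-1))
  (fun x _ => - 2 / T ^+ 2 * x^-1 * x^-1)); [solve_bounded_on..|].
move=> x s y v x0; rewrite /vega_weight.
by field; rewrite !gt_eqF.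
Qed.

End domination.

Section greek_estimate_bound.
Context {R : realType}.
Variables (S0 r sigma T K H : R) (d : nat).
Hypotheses (S0_gt0 : 0 < S0) (T_gt0 : 0 < T) (d_gt0 : (0 < d)%N)
  (K_gt0 : 0 < K) (le_KH : K <= H).

(** On the support of the barrier payoff the average is at most H, hence every
    price S_j is at most d H. What remains unbounded in y and z is linear in the
    Brownian values, so exponential moments never come into play. *)
Lemma greek_estimate_bound weight :
  linear_growth K H (d%:R * H) weight ->
  exists2 C, 0 <= C & forall w,
    `|greek_estimate S0 r sigma T d w (up_and_out_call K H) weight| <=
    C * (1 + \sum_(1 <= j < d.+1) `|w (mon_date T d j) - sigma * mon_date T d j|).
Proof.
move=> [Cw Cw0 wC]; pose N := d%:R * H.
have dR : 0 < d%:R :> R by rewrite ltr0n.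
have H0 : 0 < H by exact: lt_le_trans le_KH.
have N0 : 0 <= N by rewrite mulr_ge0 ?ltW.
pose Cy := T / d%:R * N; pose Cz := T ^+ 2 / d%:R ^+ 2 * (N ^+ 2 *+ d).
have Td0 : 0 <= T / d%:R by rewrite divr_ge0 ?ltW.
have Cy0 : 0 <= Cy by rewrite mulr_ge0.
have Cz0 : 0 <= Cz.
  by rewrite mulr_ge0 ?divr_ge0 ?sqr_ge0// mulrn_wge0// sqr_ge0.
exists (expR (- r * T) * H * (Cw * (1 + Cy + Cz))).
  by rewrite !mulr_ge0 ?expR_ge0 ?addr_ge0 ?(ltW H0).
move=> w; set m := \sum_(_ <= _ < _) _.
have m0 : 0 <= m by exact: sumr_ge0.
rewrite /greek_estimate; set avg := stock_avg S0 r sigma T d w.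
set y := path_y _ _ _ _ _ _; set v := path_z _ _ _ _ _ _.
pose S j := stock S0 r sigma w (mon_date T d j).
have S_gt0 j : 0 <= S j by rewrite mulr_ge0 ?expR_ge0 ?ltW.
rewrite 2!normrM (ger0_norm (expR_ge0 _)) -!mulrA ler_wpM2l ?expR_ge0//.
rewrite /up_and_out_call; case: (leP avg H) => avgH; last first.
  by rewrite mulr0 normr0 mul0r !mulr_ge0 ?addr_ge0 ?(ltW H0).
case: (leP avg K) => avgK.
  rewrite max_r ?subr_le0// mul0r normr0 mul0r.
  by rewrite !mulr_ge0 ?addr_ge0 ?(ltW H0).
rewrite mulr1 max_l ?subr_ge0 ?(ltW avgK)// ger0_norm ?subr_ge0 ?(ltW avgK)//.
have avgE : \sum_(1 <= j < d.+1) S j = d%:R * avg by rewrite mulVKf// gt_eqF.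
have SN j : (0 < j <= d)%N -> S j <= N.
  move=> jd; rewrite (@le_trans _ _ (d%:R * avg))//; last by rewrite ler_pM2l.
  rewrite -avgE (bigD1_seq j) ?iota_uniq ?mem_index_iota ?ltnS//=.
  by rewrite lerDl sumr_ge0.
have yC : `|y| <= Cy * m.
  rewrite normrM (ger0_norm Td0) /Cy -[leRHS]mulrA ler_wpM2l//.
  rewrite mulr_sumr (le_trans (ler_norm_sum _ _ _))// ler_sum_nat// => j jd.
  by rewrite normrM (ger0_norm (S_gt0 j)) ler_wpM2r// SN.
have vC : `|v| <= Cz * m.
  rewrite normrM [X in X * _]ger0_norm ?divr_ge0 ?sqr_ge0// /Cz -[leRHS]mulrA.
  rewrite ler_wpM2l ?divr_ge0 ?sqr_ge0//.
  have -> : N ^+ 2 *+ d * m = \sum_(1 <= i < d.+1) N ^+ 2 * m.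
    by rewrite sumr_const_nat subn1 mulrnAl.
  rewrite (le_trans (ler_norm_sum _ _ _))// ler_sum_nat// => i /andP[i0 id].
  rewrite (le_trans (ler_norm_sum _ _ _))//.
  rewrite /m [X in _ <= _ * X](@big_cat_nat _ _ _ i)//=; last exact: ltnW.
rewrite mulrDr ler_wpDl ?(mulr_ge0 (sqr_ge0 N)) ?sumr_ge0//.
  rewrite mulr_sumr ler_sum_nat// => j /andP[ij jd].
  rewrite 2!normrM (ger0_norm (S_gt0 i)) (ger0_norm (S_gt0 j)) ler_wpM2r//.
  rewrite expr2; apply: ler_pM => //; apply: SN; first by rewrite i0.
  by rewrite (leq_trans i0 ij).
have wyv : `|weight avg (S d) y v| <= Cw * (1 + `|y| + `|v|).
  by apply: wC; rewrite ?(ltW avgK) ?avgH ?S_gt0 ?SN// d_gt0 leqnn.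
apply: ler_pM => //; first by rewrite subr_ge0 ltW.
  by rewrite lerBlDr (le_trans avgH)// lerDl ltW.
apply: (le_trans wyv); rewrite ler_wpM2l//.
have m1 : m <= 1 + m by rewrite lerDr.
apply: (@le_trans _ _ (1 + Cy * m + Cz * m)).
  by rewrite lerD// lerD.
rewrite !mulrDl mul1r lerD// ?lerD// ?ler_wpM2l//.
by rewrite lerDl.
Qed.

End greek_estimate_bound.

(** * The conditional estimates *)

Section conditional_estimates.
Context {R : realType} {disp : measure_display} {Omega : measurableType disp}.
Variable Q : probability Omega R.
Variables (S0 r sigma T K H : R) (d : nat) (A : 'M[R]_(d.-1))
  (W : R -> {RV Q >-> R}) (X1 : {RV Q >-> R}) (Z : 'I_(d.-1) -> {RV Q >-> R}).
Hypotheses (S0_gt0 : 0 < S0) (sigma_gt0 : 0 < sigma) (T_gt0 : 0 < T)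
  (d_gt0 : (0 < d)%N) (K_gt0 : 0 < K) (le_KH : K <= H)
  (X1_normal : standard_normal X1) (Z_normal : standard_normal_vector Z)
  (X1_Z_indep : independent_rv_vector Q X1 (fun i => Z i))
  (W_first : forall x,
     W (mon_date T d 1) x = Num.sqrt (mon_date T d 1) * X1 x)
  (W_next : forall (i : 'I_(d.-1)) x,
     W (mon_date T d i.+2) x - W (mon_date T d 1) x
     = (A *m \col_j Z j x) i 0).

Local Notation t_ j := (mon_date T d j).
Local Notation Zvec w := (\col_j Z j w).

(** The path with x put in place of X_1: the increments after t_1 depend on Z
    alone, so only the value at t_1 changes. *)
Definition reset_path (w : Omega) x t := W t w - W (t_ 1) w + Num.sqrt (t_ 1) * x.

Lemma reset_pathE w : reset_path w (X1 w) = fun t => W t w.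
Proof. by apply/funext => t; rewrite /reset_path -W_first subrK. Qed.

Lemma row_prod_increment w j : (0 < j <= d)%N ->
  row_prod A (Zvec w) j.-1 = W (t_ j) w - W (t_ 1) w.
Proof.
case: j => [//|[|i]] jd; rewrite /row_prod/= ?subrr//.
have id : (i < d.-1)%N by case: (d) jd.
by rewrite insubT -W_next.
Qed.

Lemma reset_path_date w x j : (0 < j <= d)%N ->
  reset_path w x (t_ j) = Num.sqrt (t_ 1) * x + row_prod A (Zvec w) j.-1.
Proof. by move=> jd; rewrite /reset_path row_prod_increment// addrC. Qed.

Lemma row_prod_linear j : (0 < j <= d)%N ->
  exists a : 'I_(d.-1) -> R, forall w,
  row_prod A (Zvec w) j.-1 = \sum_k a k * Z k w.
Proof.
case: j => [//|[|i]] jd.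
  by exists (fun=> 0) => w'; rewrite big1 // => k _; rewrite mul0r.
have id : (i < d.-1)%N by case: (d) jd.
exists (A (Ordinal id)) => w'; rewrite /row_prod/= insubT mxE.
by apply: eq_bigr => k _; rewrite mxE.
Qed.

Let integrable_cst c : Q.-integrable setT (EFin \o cst c).
Proof. exact: finite_measure_integrable_cst. Qed.

Let integrableZ (a : R) (f : Omega -> R) : Q.-integrable setT (EFin \o f) ->
  Q.-integrable setT (EFin \o (fun w => a * f w)).
Proof.
by move=> fi; apply: eq_integrable (integrableZl measurableT a fi).
Qed.

Let integrableD_EFin (f g : Omega -> R) : Q.-integrable setT (EFin \o f) ->
  Q.-integrable setT (EFin \o g) ->
  Q.-integrable setT (EFin \o (fun w => f w + g w)).
Proof.
by move=> fi gi; apply: eq_integrable (integrableD measurableT fi gi).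
Qed.

Let integrable_sum_EFin I (s : seq I) (f : I -> Omega -> R) :
  (forall i, Q.-integrable setT (EFin \o f i)) ->
  Q.-integrable setT (EFin \o (fun w => \sum_(i <- s) f i w)).
Proof.
move=> fi; elim: s => [|i s IH].
  apply: eq_integrable (integrable_cst 0) => // w _ /=.
  by rewrite big_nil.
apply: eq_integrable (integrableD_EFin (fi i) IH) => // w _ /=.
by rewrite big_cons.
Qed.

Lemma integrable_date j : (0 < j <= d)%N ->
  Q.-integrable setT (EFin \o W (t_ j)).
Proof.
move=> jd; have [a aE] := row_prod_linear jd.
have -> : (W (t_ j) : Omega -> R) =
    (fun w => Num.sqrt (t_ 1) * X1 w + \sum_k a k * Z k w).
  by apply/funext => w; rewrite -aE -reset_path_date// reset_pathE.
apply: integrableD_EFin; first exact/integrableZ/integrable_standard_normal.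
apply: integrable_sum_EFin => k; apply: integrableZ.
exact/integrable_standard_normal/standard_normal_coordinate.
Qed.

Lemma integrable_estimate weight :
  linear_growth K H (d%:R * H) weight ->
  (forall d' (U : measurableType d'), preserves_measurability (U := U) weight) ->
  Q.-integrable setT (EFin \o (fun w => greek_estimate S0 r sigma T d
    (fun t => W t w) (up_and_out_call K H) weight)).
Proof.
move=> growth mweight.
have [C C0 boundC] := greek_estimate_bound r sigma S0_gt0 T_gt0 d_gt0 K_gt0
  le_KH growth.
pose m w := \sum_(1 <= j < d.+1) `|W (t_ j) w - sigma * t_ j|.
have mi : Q.-integrable setT (EFin \o (fun w => C * (1 + m w))).
  apply: integrableZ; apply: integrableD_EFin.
    exact: integrable_cst.
  apply: (@eq_integrable _ _ _ _ _ measurableT (EFin \o (fun w =>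
    \sum_(j <- index_iota 1 d.+1) if (0 < j <= d)%N then
       `|W (t_ j) w - sigma * t_ j| else 0))).
    move=> w _; congr EFin; rewrite /m !big_seq; apply: eq_bigr => j.
    by rewrite mem_index_iota => ->.
  apply: integrable_sum_EFin => j.
  have [jd|_] := boolP (0 < j <= d)%N; last exact: integrable_cst.
  have : Q.-integrable setT
      (EFin \o (fun w => W (t_ j) w + - (sigma * t_ j))).
    apply: integrableD_EFin; first exact: integrable_date.
    exact: integrable_cst.
  by move/integrable_abse.
apply: le_integrable mi => //.
  apply/measurable_EFinP/measurable_greek_estimate => //.
  exact: measurable_up_and_out_call.
move=> w _ /=; rewrite lee_fin (le_trans (boundC _))//.
exact: ler_norm.
Qed.

(** The theorem for one Greek. What depends on the Greek is its weight and the
    list L z of triples that represents the weight when Z = z; G1 and G2 are the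
    binary and call formulas. *)
Lemma barrier_cond_expectation weight
    (L : 'cV[R]_(d.-1) -> seq (R * R * R)) (G1 G2 : 'cV[R]_(d.-1) -> R -> R) :
  linear_growth K H (d%:R * H) weight ->
  (forall d' (U : measurableType d'), preserves_measurability (U := U) weight) ->
  (forall z x, let g := first_factor r sigma T d x in
     let SA := tstock_avg S0 r sigma T A z in
     expR (- r * T) * weight (g * SA) (g * tstock S0 r sigma T A z d)
       (T / d%:R * g * (Defs.coefB S0 r sigma T A z +
          Num.sqrt (t_ 1) * x * (d%:R * SA)))
       (T ^+ 2 / d%:R ^+ 2 * g ^+ 2 * (Defs.coefC S0 r sigma T A z +
          Num.sqrt (t_ 1) * x * Defs.coefD S0 r sigma T A z))
     = \sum_(t <- L z) tilted_affine t x) ->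
  (forall z k, G1 z k =
     \sum_(t <- L z) tilted_primitive t (psi S0 r sigma T A z k)) ->
  (forall z k, G2 z k =
     \sum_(t <- map (times_avg S0 r sigma T A z) (L z))
       tilted_primitive t (psi S0 r sigma T A z k) - k * G1 z k) ->
  is_cond_expectation Q (fun i => Z i)
    (fun w => greek_estimate S0 r sigma T d (fun t => W t w)
       (up_and_out_call K H) weight)
    (fun w => G2 (Zvec w) K - (G2 (Zvec w) H + (H - K) * G1 (Zvec w) H)).
Proof.
move=> growth mweight weightE G1E G2E.
pose h w x := greek_estimate S0 r sigma T d (reset_path w x)
  (up_and_out_call K H) weight.
have hX1 : (fun w => greek_estimate S0 r sigma T d (fun t => W t w)
    (up_and_out_call K H) weight) = (fun w => h w (X1 w)).
  by apply/funext => w; rewrite /h reset_pathE.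
rewrite hX1; apply: cond_expectation_independent => //.
- apply: measurable_greek_estimate => //; last exact: measurable_up_and_out_call.
  move=> j jd; have [a aE] := row_prod_linear jd.
  rewrite [X in measurable_fun _ X](_ : _ = (fun z =>
    Num.sqrt (t_ 1) * z.2 + \sum_k a k * Z k z.1)); last first.
    by apply/funext => z; rewrite reset_path_date// aE.
  apply: measurable_funD; first exact: measurable_funM.
  apply: measurable_sum => k; apply: measurable_funM => //.
  have mZ := @measurable_coordinate _ _ _ Q _ Z k.
  exact: (measurableT_comp mZ measurable_fst).
- by rewrite -hX1; exact: integrable_estimate.
- move=> w.
  rewrite (integral_standard_normal (f := fun x => (h w x)%:E) X1_normal).
    apply: (integral_greek_estimate S0_gt0 sigma_gt0 T_gt0 d_gt0 _ K_gt0 le_KH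
      (weightE (Zvec w)) (G1E (Zvec w)) (G2E (Zvec w))).
    by move=> x j jd; exact: reset_path_date.
  apply/measurable_EFinP/measurable_greek_estimate => //.
    move=> j jd; rewrite [X in measurable_fun _ X](_ : _ = (fun x =>
      Num.sqrt (t_ 1) * x + row_prod A (Zvec w) j.-1)); last first.
      by apply/funext => x; rewrite reset_path_date.
    by apply: measurable_funD => //; exact: measurable_funM.
  exact: measurable_up_and_out_call.
Qed.

End conditional_estimates.

Theorem theorem6p6 (R : realType) (disp : measure_display)
    (Omega : measurableType disp) (Q : probability Omega R)
    (S0 r sigma T K H : R) (d : nat) (A : 'M[R]_(d.-1))
    (W : R -> {RV Q >-> R}) (X1 : {RV Q >-> R})
    (Z : 'I_(d.-1) -> {RV Q >-> R})
    (S0_gt0 : 0 < S0) (r_gt0 : 0 < r) (sigma_gt0 : 0 < sigma) (T_gt0 : 0 < T)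
    (d_ge2 : (2 <= d)%N) (K_gt0 : 0 < K) (le_KH : K <= H)
    (W_bm : brownian_motion T W)
    (A_chol : A *m A^T = increment_cov T d)
    (X1_normal : standard_normal X1)
    (Z_normal : standard_normal_vector Z)
    (X1_Z_indep : independent_rv_vector Q X1 (fun i => Z i))
    (W_first : forall x, W (mon_date T d 1) x = Num.sqrt (mon_date T d 1) * X1 x)
    (W_next : forall (i : 'I_(d.-1)) x,
       W (mon_date T d i.+2) x - W (mon_date T d 1) x
       = (A *m \col_j Z j x) i 0) :
  let path x : R -> R := fun t => W t x in
  let Zvec x : 'cV[R]_(d.-1) := \col_j Z j x in
  let theta weight x :=
    greek_estimate S0 r sigma T d (path x) (up_and_out_call K H) weight in
  [/\ is_cond_expectation Q (fun i => Z i)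
        (theta (delta_weight S0 r sigma T))
        (fun x => G_delta3 S0 r sigma T A (Zvec x) K H),
      is_cond_expectation Q (fun i => Z i)
        (theta (gamma_weight S0 r sigma T))
        (fun x => G_gamma3 S0 r sigma T A (Zvec x) K H)
    & is_cond_expectation Q (fun i => Z i)
        (theta (vega_weight S0 r sigma T))
        (fun x => G_vega3 S0 r sigma T A (Zvec x) K H)].
Proof.
have d_gt0 : (0 < d)%N by exact: leq_trans d_ge2.
have estimate := barrier_cond_expectation S0_gt0 sigma_gt0 T_gt0 d_gt0 K_gt0
  le_KH X1_normal Z_normal X1_Z_indep W_first W_next.
move=> path Zvec theta; split.
- apply: (estimate r _ (delta_terms S0 r sigma T A) (G_delta1 S0 r sigma T A)
    (G_delta2 S0 r sigma T A)).
  + exact: linear_growth_delta_weight.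
  + by move=> ? ?; exact: measurable_delta_weight.
  + by move=> z x g SA; exact: delta_weight_terms.
  + by move=> z k; exact: delta_terms1.
  + by move=> z k; exact: delta_terms2.
- apply: (estimate r _ (gamma_terms S0 r sigma T A) (G_gamma1 S0 r sigma T A)
    (G_gamma2 S0 r sigma T A)).
  + exact: linear_growth_gamma_weight.
  + by move=> ? ?; exact: measurable_gamma_weight.
  + by move=> z x g SA; exact: gamma_weight_terms.
  + by move=> z k; exact: gamma_terms1.
  + by move=> z k; exact: gamma_terms2.
- apply: (estimate r _ (vega_terms S0 r sigma T A) (G_vega1 S0 r sigma T A)
    (G_vega2 S0 r sigma T A)).
  + exact: linear_growth_vega_weight.
  + by move=> ? ?; exact: measurable_vega_weight.
  + by move=> z x; exact: vega_weight_terms.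
  + by move=> z k; exact: vega_terms1.
  + by move=> z k; exact: vega_terms2.
Qed.
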